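(* Let $K$ be a locally finite systolic simplicial complex. Then $K$ has an arborescent structure: there is a sequence of finite subcomplexes $L_1\subseteq L_2\subseteq \cdots$ of $K$, each of which is collapsible, such that $K=\bigcup_{n=1}^{\infty} L_n$. *)

(* Defs.v *)
From Stdlib Require Import List Relations.
Import ListNotations.

Section SC.
Variable V : Type.

Definition vset := V -> Prop.
Definition subset (s t : vset) : Prop := forall x, s x -> t x.
Definition same_set (s t : vset) : Prop := forall x, s x <-> t x.
Definition finite_vset (s : vset) : Prop := exists l : list V, forall x, s x <-> In x l.
Definition nonempty (s : vset) : Prop := exists x, s x.

Definition cplx := vset -> Prop.

Definition is_complex (K : cplx) : Prop :=
  (forall s, K s -> finite_vset s /\ nonempty s) /\
  (forall s t, K s -> nonempty t -> subset t s -> K t).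

Definition vertex (K : cplx) (v : V) : Prop := K (fun x => x = v).
Definition edge (K : cplx) (u v : V) : Prop := K (fun x => x = u \/ x = v).

Definition subcomplex (L K : cplx) : Prop :=
  is_complex L /\ forall s, L s -> K s.

Definition finite_cplx (K : cplx) : Prop :=
  exists l : list V, forall s, K s -> forall x, s x -> In x l.

(* locally finite: every vertex lies in finitely many simplices *)
Definition locally_finite (K : cplx) : Prop :=
  forall v, vertex K v ->
    exists l : list V, forall s, K s -> s v -> forall x, s x -> In x l.

Definition strict_subset (s t : vset) : Prop := subset s t /\ ~ subset t s.

Definition free_face (K : cplx) (sigma tau : vset) : Prop :=
  K sigma /\ K tau /\ strict_subset sigma tau /\
  (forall rho, K rho -> subset sigma rho -> same_set rho sigma \/ same_set rho tau).

Definition remove_pair (K : cplx) (sigma tau : vset) : cplx :=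
  fun rho => K rho /\ ~ same_set rho sigma /\ ~ same_set rho tau.

Inductive collapsible : cplx -> Prop :=
| coll_point : forall (K : cplx) (v : V),
    (forall s, K s <-> same_set s (fun x => x = v)) -> collapsible K
| coll_step : forall (K : cplx) sigma tau,
    free_face K sigma tau -> collapsible (remove_pair K sigma tau) -> collapsible K.

Definition flag (K : cplx) : Prop :=
  forall s, finite_vset s -> nonempty s ->
    (forall x, s x -> vertex K x) ->
    (forall x y, s x -> s y -> x <> y -> edge K x y) -> K s.

Definition cycles4_have_diagonal (K : cplx) : Prop :=
  forall a b c d : V,
    NoDup [a; b; c; d] ->
    edge K a b -> edge K b c -> edge K c d -> edge K d a ->
    edge K a c \/ edge K b d.

Definition cycles5_have_diagonal (K : cplx) : Prop :=
  forall a b c d e : V,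
    NoDup [a; b; c; d; e] ->
    edge K a b -> edge K b c -> edge K c d -> edge K d e -> edge K e a ->
    edge K a c \/ edge K a d \/ edge K b d \/ edge K b e \/ edge K c e.

Definition six_large (K : cplx) : Prop :=
  flag K /\ cycles4_have_diagonal K /\ cycles5_have_diagonal K.

Definition link (K : cplx) (sigma : vset) : cplx :=
  fun tau => K tau /\ (forall x, tau x -> ~ sigma x) /\
             K (fun x => tau x \/ sigma x).

Definition locally_six_large (K : cplx) : Prop :=
  forall sigma, K sigma -> six_large (link K sigma).

Definition connected (K : cplx) : Prop :=
  (exists v, vertex K v) /\
  forall u v, vertex K u -> vertex K v ->
    clos_refl_trans V (edge K) u v.

Fixpoint edge_path (K : cplx) (p : list V) : Prop :=
  match p with
  | [] => False
  | [a] => vertex K a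
  | a :: ((b :: _) as q) => (a = b \/ edge K a b) /\ vertex K a /\ edge_path K q
  end.

Inductive path_move (K : cplx) : list V -> list V -> Prop :=
| pm_tri : forall l1 l2 a b c,
    K (fun x => x = a \/ x = b \/ x = c) ->
    path_move K (l1 ++ [a; b; c] ++ l2) (l1 ++ [a; c] ++ l2)
| pm_stutter : forall l1 l2 a,
    path_move K (l1 ++ [a; a] ++ l2) (l1 ++ [a] ++ l2).

Definition path_homotopic (K : cplx) : list V -> list V -> Prop :=
  clos_refl_sym_trans (list V) (path_move K).

Definition simply_connected (K : cplx) : Prop :=
  connected K /\
  forall (v : V) (p : list V), edge_path K (v :: p ++ [v]) ->
    path_homotopic K (v :: p ++ [v]) [v].

Definition systolic (K : cplx) : Prop :=
  is_complex K /\ connected K /\ simply_connected K /\ locally_six_large K.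

End SC.

Arguments subset {V}. Arguments same_set {V}. Arguments is_complex {V}.
Arguments subcomplex {V}. Arguments finite_cplx {V}. Arguments locally_finite {V}.
Arguments collapsible {V}. Arguments systolic {V}.

(* Main.v *)
(** Build the universal cover of [K] level by level around a base vertex [o]. At each
    stage the cover is a ball in which the vertices below a given vertex form a
    clique and adjacent vertices of equal level have a common neighbour one level
    down; the absence of empty 4- and 5-cycles in vertex links is exactly what lets
    these properties pass to the next level. Since [K] is simply connected, the cover
    is [K] itself, so the properties hold for the distance [d] from [o]. They imply
    that the vertices at distance [n] adjacent to all of a simplex [s] of the sphere
    of radius [n + 1] form with [s] a simplex strictly larger than [s]. Therefore the
    stars of the simplices of that sphere can be collapsed away, largest first, and
    every ball is collapsible. *)

Require Import Defs.
From Stdlib Require Import List Arith Lia Relations Classical ClassicalEpsilon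
  FunctionalExtensionality PropExtensionality.
Import ListNotations.

Lemma pred_ext {A : Type} (P Q : A -> Prop) : (forall a, P a <-> Q a) -> P = Q.
Proof.
  intros H; apply functional_extensionality; intros a.
  apply propositional_extensionality, H.
Qed.

(** * Faces, edges and triangles *)

Section Faces.
Variables (V : Type) (K : (V -> Prop) -> Prop).
Hypothesis Kc : is_complex K.

(* Adjacency and triangles are taken reflexively: vertices may coincide, so that the
   star lemmas below need no distinctness hypotheses. *)
Definition edge_or_eq (a b : V) : Prop := K (fun x => x = a \/ x = b).
Definition triangle (a b c : V) : Prop := K (fun x => x = a \/ x = b \/ x = c).

Local Notation E := edge_or_eq.
Local Notation T := triangle.

Lemma face (s t : V -> Prop) x : K s -> t x -> (forall x, t x -> s x) -> K t.
Proof. intros Hs Hx Hst; apply (proj2 Kc s t); [easy | now exists x | easy]. Qed.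

Lemma edge_sym a b : E a b -> E b a.
Proof. intros H; apply (face _ _ a H); tauto. Qed.
Lemma edge_vertex a b : E a b -> vertex V K a.
Proof. intros H; apply (face _ _ a H); [easy | tauto]. Qed.
Lemma vertex_edge a : vertex V K a -> E a a.
Proof. intros H; apply (face _ _ a H); tauto. Qed.

Lemma triangle_edge a b c : T a b c -> E b c.
Proof. intros H; apply (face _ _ b H); tauto. Qed.
Lemma triangle_edge12 a b c : T a b c -> E a b.
Proof. intros H; apply (face _ _ a H); tauto. Qed.
Lemma triangle_edge13 a b c : T a b c -> E a c.
Proof. intros H; apply (face _ _ a H); tauto. Qed.
Lemma triangle_swap a b c : T a b c -> T a c b.
Proof. intros H; apply (face _ _ b H); tauto. Qed.
Lemma triangle_rot a b c : T a b c -> T b c a.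
Proof. intros H; apply (face _ _ b H); tauto. Qed.
Lemma triangle_sym a b c : T a b c -> T b a c.
Proof. intros H; apply (face _ _ b H); tauto. Qed.
Lemma edge_triangle a b : E a b -> T a b b.
Proof. intros H; apply (face _ _ b H); tauto. Qed.
Lemma edge_triangle' a b : E a b -> T a a b.
Proof. intros H; apply (face _ _ b H); tauto. Qed.

End Faces.

(** The six branches are the six orderings of the vertices of a triangle. *)
Ltac perm :=
  assumption || (apply triangle_swap; assumption) || (apply triangle_rot; assumption) ||
  (apply triangle_sym; assumption) ||
  (apply triangle_rot; [|apply triangle_rot]; assumption) ||
  (apply triangle_sym; [|apply triangle_rot]; assumption).

(** * Short cycles and cliques in vertex links *)

Section Links.
Variables (V : Type) (K : (V -> Prop) -> Prop).
Hypothesis Kc : is_complex K.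
Hypothesis Kl : locally_six_large V K.

Local Notation T := (triangle V K).

Lemma link_edge a b c : T a b c -> b <> a -> c <> a -> edge V (link V K (fun x => x = a)) b c.
Proof.
  intros H Hb Hc. split; [|split].
  - apply (triangle_edge V K Kc _ _ _ H).
  - intros x [->| ->]; easy.
  - apply (face V K Kc _ _ b H); tauto.
Qed.

Lemma link_edge_inv a b c : edge V (link V K (fun x => x = a)) b c -> T a b c.
Proof. intros (_ & _ & H). apply (face V K Kc _ _ a H); tauto. Qed.

(** If two of the five vertices coincide, a given triangle or one of its faces is already a
    diagonal. Otherwise [p q r s] is a genuine 4-cycle in the link of [a]. *)
Lemma star_four_cycle a p q r s :
  T a p q -> T a q r -> T a r s -> T a s p -> T a p r \/ T a q s.
Proof.
  intros Hpq Hqr Hrs Hsp.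
  destruct (classic (p = a)) as [->|np].
  { left. apply (face V K Kc _ _ a Hqr); tauto. }
  destruct (classic (r = a)) as [->|nr].
  { left. apply (face V K Kc _ _ a Hpq); tauto. }
  destruct (classic (q = a)) as [->|nq].
  { right. apply (face V K Kc _ _ a Hrs); tauto. }
  destruct (classic (s = a)) as [->|ns].
  { right. apply (face V K Kc _ _ a Hpq); tauto. }
  destruct (classic (p = q)) as [->|npq]; [now left|].
  destruct (classic (q = r)) as [->|nqr]; [now left|].
  destruct (classic (r = s)) as [->|nrs]; [now right|].
  destruct (classic (s = p)) as [->|nsp]; [left; perm|].
  destruct (classic (p = r)) as [->|npr]; [left; apply (face V K Kc _ _ a Hrs); tauto|].
  destruct (classic (q = s)) as [->|nqs]; [right; apply (face V K Kc _ _ a Hrs); tauto|].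
  assert (Ha : K (fun x => x = a)) by (apply (face V K Kc _ _ a Hpq); tauto).
  destruct (Kl _ Ha) as (_ & H4 & _).
  destruct (H4 p q r s) as [H|H]; try (apply link_edge; assumption).
  - repeat constructor; simpl; intuition congruence.
  - left; now apply link_edge_inv.
  - right; now apply link_edge_inv.
Qed.

(** As for 4-cycles, coincidences yield a diagonal at once, and a genuine 5-cycle lies in the link
    of [a]. *)
Lemma star_five_cycle a p q r s t :
  T a p q -> T a q r -> T a r s -> T a s t -> T a t p ->
  T a p r \/ T a p s \/ T a q s \/ T a q t \/ T a r t.
Proof.
  intros Hpq Hqr Hrs Hst Htp.
  destruct (classic (p = a)) as [->|np].
  { left. apply (face V K Kc _ _ a Hrs); tauto. }
  destruct (classic (q = a)) as [->|nq].
  { right; right; left. apply (face V K Kc _ _ a Hst); tauto. }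
  destruct (classic (r = a)) as [->|nr].
  { left. apply (face V K Kc _ _ a Hpq); tauto. }
  destruct (classic (s = a)) as [->|ns].
  { right; left. apply (face V K Kc _ _ a Hpq); tauto. }
  destruct (classic (t = a)) as [->|nt].
  { right; right; right; left. apply (face V K Kc _ _ a Hqr); tauto. }
  destruct (classic (p = q)) as [->|npq]; [now left|].
  destruct (classic (q = r)) as [->|nqr]; [now left|].
  destruct (classic (r = s)) as [->|nrs]; [tauto|].
  destruct (classic (s = t)) as [->|nst]; [tauto|].
  destruct (classic (t = p)) as [->|ntp]; [right; left; perm|].
  destruct (classic (p = r)) as [->|npr]; [left; apply (face V K Kc _ _ a Hrs); tauto|].
  destruct (classic (p = s)) as [->|nps]; [right; left; apply (face V K Kc _ _ a Hrs); tauto|].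
  destruct (classic (q = s)) as [->|nqs]; [right; right; left; apply (face V K Kc _ _ a Hrs); tauto|].
  destruct (classic (q = t)) as [->|nqt].
  { right; right; right; left; apply (face V K Kc _ _ a Hst); tauto. }
  destruct (classic (r = t)) as [->|nrt].
  { right; right; right; right; apply (face V K Kc _ _ a Hst); tauto. }
  assert (Ha : K (fun x => x = a)) by (apply (face V K Kc _ _ a Hpq); tauto).
  destruct (Kl _ Ha) as (_ & _ & H5).
  destruct (H5 p q r s t) as [H|[H|[H|[H|H]]]]; try (apply link_edge; assumption);
    try (apply link_edge_inv in H; tauto).
  repeat constructor; simpl; intuition congruence.
Qed.

(** Flagness of the link of [a] is applied to [s] with [a] removed. Simplices are nonempty, so the
    case where nothing remains is treated apart. *)
Lemma star_flag a (s : V -> Prop) :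
  vertex V K a -> finite_vset V s -> (forall x y, s x -> s y -> T a x y) ->
  K (fun x => x = a \/ s x).
Proof.
  intros Ha (l & Hl) Hs.
  destruct (classic (exists x, s x /\ x <> a)) as [(x0 & Hx0 & nx0)|none].
  2:{ apply (face V K Kc _ _ a Ha); [tauto|]. intros x [?|Hx]; [easy|].
      apply NNPP; intros nx; apply none; now exists x. }
  assert (HL : link V K (fun x => x = a) (fun x => s x /\ x <> a)).
  { apply (proj1 (Kl _ Ha)).
    - exists (filter (fun x => if excluded_middle_informative (x = a) then false else true) l).
      intros x; rewrite filter_In, <- Hl.
      destruct (excluded_middle_informative (x = a)); intuition congruence.
    - now exists x0.
    - intros x (Hx & nx).
      destruct (link_edge a x x (Hs x x Hx Hx) nx nx) as (H1 & H2 & H3).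
      split; [|split].
      + apply (face V K Kc _ _ x H1); tauto.
      + now intros y ->.
      + apply (face V K Kc _ _ x H3); tauto.
    - intros x y (Hx & nx) (Hy & ny) _. apply link_edge; auto. }
  destruct HL as (_ & _ & H). apply (face V K Kc _ _ a H); [tauto|].
  intros x [->|Hx]; [tauto|]. destruct (classic (x = a)); tauto.
Qed.

(** Since the link of [a] is flag, [a p q r] spans a simplex, and [p q r] is a face of it. *)
Lemma star_triangle a p q r : T a p q -> T a q r -> T a p r -> T p q r.
Proof.
  intros Hpq Hqr Hpr.
  assert (H : K (fun x => x = a \/ (x = p \/ x = q \/ x = r))).
  { apply star_flag.
    - apply (face V K Kc _ _ a Hpq); [easy|tauto].
    - exists [p; q; r]; intros x; simpl; intuition congruence.
    - assert (T a p p) by (apply (face V K Kc _ _ a Hpq); tauto).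
      assert (T a q q) by (apply (face V K Kc _ _ a Hpq); tauto).
      assert (T a r r) by (apply (face V K Kc _ _ a Hpr); tauto).
      intros x y [->|[->| ->]] [->|[->| ->]]; perm. }
  apply (face V K Kc _ _ p H); tauto.
Qed.

End Links.

(** * Partial covers and classes of missing edges *)

Section Cover.
Variables (V : Type) (K : (V -> Prop) -> Prop) (o : V).
Hypothesis Kc : is_complex K.
Hypothesis Kl : locally_six_large V K.

Local Notation E := (edge_or_eq V K).
Local Notation T := (triangle V K).
Local Notation f := (hd o).

(* A vertex of the cover is a list: [hd o] is its image in [K], its length minus one
   is its level. [R] is reflexive adjacency, with domain [fun x => R x x]; [n] bounds
   the lengths, and stars are complete only below length [n]. *)
Record partial_cover (n : nat) (R : list V -> list V -> Prop) : Prop := {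
  pc_sym : forall x y, R x y -> R y x;
  pc_refl : forall x y, R x y -> R x x;
  pc_base : R [o] [o];
  pc_base_uniq : forall x, R x x -> length x = 1 -> x = [o];
  pc_len : forall x, R x x -> 1 <= length x <= n;
  pc_len_step : forall x y, R x y -> length y <= S (length x);
  pc_edge : forall x y, R x y -> E (f x) (f y);
  pc_inj : forall u a b, R u a -> R u b -> f a = f b -> a = b;
  pc_tri : forall u a b, R u a -> R u b -> (R a b <-> T (f u) (f a) (f b));
  pc_full : forall u z, R u u -> length u < n -> E (f u) z ->
    exists y, R u y /\ f y = z;
  pc_common : forall x y i, R x y -> length x = S (S i) -> length y = S (S i) ->
    exists u, length u = S i /\ R u x /\ R u y;
  pc_down : forall u v x, R u x -> R v x -> length u = length v ->
    length x = S (length u) -> R u v }.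

Section Step.
Variables (n : nat) (R : list V -> list V -> Prop).
Hypothesis C : partial_cover n R.

(* The edge from [w] to [z] does not lift yet. *)
Definition missing (w : list V) (z : V) : Prop :=
  R w w /\ length w = n /\ E (f w) z /\ ~ exists y, R w y /\ f y = z.

(* [(w, z)] and [(w', z)] must yield the same new vertex over [z]. *)
Definition twin (z : V) (w w' : list V) : Prop :=
  missing w z /\ missing w' z /\ R w w' /\ T (f w) (f w') z.

(* [epsilon] selects one representative of the class of [twin z], so that twins give
   equal lists. *)
Definition new (w : list V) (z : V) : list V :=
  z :: epsilon (inhabits []) (twin z w).

(** In [ext_new] a single old vertex lies below both new ones, so [pc_common] holds at the new level
    by construction. The case [z = z'] makes new vertices adjacent to themselves. *)
Inductive extend : list V -> list V -> Prop :=
| ext_old x y : R x y -> extend x y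
| ext_up w z : missing w z -> extend w (new w z)
| ext_down w z : missing w z -> extend (new w z) w
| ext_new u z z' : missing u z -> missing u z' -> T (f u) z z' ->
    extend (new u z) (new u z').

(** The star of [p] is already complete, so [z] lifts to a neighbour of [p]. The triangle would make
    this lift adjacent to [w], but the edge from [w] to [z] has no lift. *)
Lemma missing_lower w z p :
  missing w z -> R p w -> length p < n -> ~ T (f p) (f w) z.
Proof.
  intros (Hw & Lw & _ & no) Hp Lp Ht.
  destruct (pc_full _ _ C p z) as (y & Hy & <-); auto.
  - apply (pc_refl _ _ C _ _ Hp).
  - apply (triangle_edge V K Kc (f w)). perm.
  - apply no; exists y; split; [|easy].
    now apply (pc_tri _ _ C p).
Qed.

(** A lift of the edge at [w'] would, by [pc_tri], be adjacent to [w] as well. *)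
Lemma missing_spread w w' z :
  missing w z -> R w w' -> length w' = n -> T (f w) (f w') z -> missing w' z.
Proof.
  intros (Hw & Lw & Ez & no) Hww L Ht.
  assert (Hs := pc_sym _ _ C _ _ Hww).
  split; [|split; [easy|split]].
  - apply (pc_refl _ _ C _ _ Hs).
  - apply (triangle_edge V K Kc (f w)). perm.
  - intros (y & Hy & <-). apply no; exists y; split; [|easy].
    apply (pc_tri _ _ C w'); auto; perm.
Qed.

Lemma twin_refl w z : missing w z -> twin z w w.
Proof.
  intros H. split; [|split; [|split]]; auto; [apply H|].
  apply edge_triangle'; auto. apply H.
Qed.

Lemma twin_sym z w w' : twin z w w' -> twin z w' w.
Proof.
  intros (H & H' & Hr & Ht). repeat split; try apply H; try apply H'.
  - now apply (pc_sym _ _ C).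
  - perm.
Qed.

(* The path [w, z, w''] in the link of [w'] closes up through common lower neighbours
   [p], [q]; a diagonal from [z] to [p] or [q] would provide the missing edge. *)
Lemma twin_trans z w w' w'' : twin z w w' -> twin z w' w'' -> twin z w w''.
Proof.
  intros (Hw & Hw' & Hr & Ht) (_ & Hw'' & Hr' & Ht').
  assert (Hs := pc_sym _ _ C _ _ Hr).
  assert (goal : T (f w') (f w) (f w'') -> twin z w w'').
  { intros H. split; [|split; [|split]]; auto.
    - now apply (pc_tri _ _ C w').
    - apply (star_triangle V K Kc Kl (f w')); perm. }
  assert (L : length w = n) by apply Hw.
  assert (L' : length w' = n) by apply Hw'.
  assert (L'' : length w'' = n) by apply Hw''.
  assert (R w w) by apply Hw. assert (R w' w') by apply Hw'.
  assert (R w'' w'') by apply Hw''.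
  assert (n1 := pc_len _ _ C w' (proj1 Hw')).
  (* At [n = 1] the only vertex is [[o]]; from [n = 2] on there is a lower level to supply [p] and
     [q]. *)
  destruct n as [|[|i]] eqn:En; [lia| |].
  { assert (w = [o]) by now apply (pc_base_uniq _ _ C).
    assert (w' = [o]) by now apply (pc_base_uniq _ _ C).
    subst w w'. split; [|split]; auto. }
  rewrite <- En in *.
  (* A lower vertex [p] joined to [w], [w'] and [w''] closes a 4-cycle around [w']. Its diagonal
     from [z] to [p] is excluded, so [w] and [w''] are joined. *)
  assert (four : forall p, length p < n -> R p w' ->
    T (f w') (f w) (f p) -> T (f w') (f p) (f w'') -> twin z w w'').
  { intros p Lp Hp Ha Hb.
    destruct (star_four_cycle V K Kc Kl (f w') (f w) z (f w'') (f p)) as [D|D];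
      try perm; auto.
    exfalso; apply (missing_lower w' z p Hw' Hp Lp); perm. }
  destruct (pc_common _ _ C w w' i) as (p & Lp & Hp & Hp'); try congruence.
  destruct (pc_common _ _ C w' w'' i) as (q & Lq & Hq' & Hq); try congruence.
  assert (Hpq : R p q) by (apply (pc_down _ _ C _ _ w'); auto; congruence).
  assert (T (f w') (f w) (f p)).
  { apply (pc_tri _ _ C w'); auto; now apply (pc_sym _ _ C). }
  assert (T (f w') (f p) (f q)).
  { apply (pc_tri _ _ C w'); auto; now apply (pc_sym _ _ C). }
  assert (T (f w') (f q) (f w'')).
  { apply (pc_tri _ _ C w'); auto; now apply (pc_sym _ _ C). }
  destruct (star_five_cycle V K Kc Kl (f w') (f w) z (f w'') (f q) (f p))
    as [D|[D|[D|[D|D]]]]; try perm.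
  - auto.
  - apply (four q); auto; lia.
  - exfalso; apply (missing_lower w' z q Hw' Hq'); [lia|perm].
  - exfalso; apply (missing_lower w' z p Hw' Hp'); [lia|perm].
  - apply (four p); auto; [lia|perm].
Qed.

Lemma new_spec w z : missing w z -> twin z w (epsilon (inhabits []) (twin z w)).
Proof. intros H; apply epsilon_spec; exists w; now apply twin_refl. Qed.

Lemma new_length w z : missing w z -> length (new w z) = S n.
Proof.
  intros H; simpl; f_equal. destruct (new_spec w z H) as (_ & (_ & L & _) & _).
  exact L.
Qed.

(** Both vertices are twins of the common representative. *)
Lemma new_eq w w' z :
  missing w z -> missing w' z -> new w z = new w' z -> twin z w w'.
Proof.
  intros H H' [= e]. apply new_spec in H, H'. rewrite <- e in H'.
  eapply twin_trans; [exact H|now apply twin_sym].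
Qed.

(** By symmetry and transitivity the two classes agree as predicates, so [epsilon] receives equal
    arguments. *)
Lemma twin_new w w' z : twin z w w' -> new w z = new w' z.
Proof.
  intros H. unfold new. f_equal. f_equal. apply pred_ext; intros a; split; intros Ha.
  - eapply twin_trans; [apply twin_sym, H|exact Ha].
  - eapply twin_trans; [exact H|exact Ha].
Qed.

Lemma old_len x y : R x y -> length x <= n /\ length y <= n.
Proof.
  intros H; split; apply (pc_len _ _ C).
  - apply (pc_refl _ _ C _ _ H).
  - apply (pc_refl _ _ C y x), (pc_sym _ _ C), H.
Qed.

(** * Adjacency in the extended cover *)

Lemma extend_sym x y : extend x y -> extend y x.
Proof.
  intros [a b H|w z H|w z H|u z z' H H' Ht].
  - now apply ext_old, (pc_sym _ _ C).
  - now apply ext_down.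
  - now apply ext_up.
  - apply ext_new; auto; perm.
Qed.

Lemma extend_old x y : extend x y -> length x <= n -> length y <= n -> R x y.
Proof.
  intros [a b H|w z H|w z H|u z z' H H' Ht] Lx Ly; auto;
    exfalso; rewrite ?(new_length _ _ H) in *; lia.
Qed.

Lemma extend_up w x : extend w x -> length w <= n -> length x = S n ->
  missing w (f x) /\ x = new w (f x).
Proof.
  intros [a b H|w' z H|w' z H|u z z' H H' Ht] Lw Lx.
  - apply old_len in H; lia.
  - auto.
  - rewrite (new_length _ _ H) in Lw; lia.
  - rewrite (new_length _ _ H) in Lw; lia.
Qed.

Lemma extend_new x y : extend x y -> length x = S n -> length y = S n ->
  exists u, missing u (f x) /\ missing u (f y) /\ T (f u) (f x) (f y) /\
    x = new u (f x) /\ y = new u (f y).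
Proof.
  intros [a b H|w z H|w z H|u z z' H H' Ht] Lx Ly.
  - apply old_len in H; lia.
  - assert (length w = n) by apply H; lia.
  - assert (length w = n) by apply H; lia.
  - exists u; auto.
Qed.

Lemma extend_len x y : extend x y ->
  1 <= length x <= S n /\ length y <= S n /\ length y <= S (length x).
Proof.
  intros [a b H|w z H|w z H|u z z' H H' Ht].
  - assert (H1 := old_len _ _ H).
    assert (H2 := pc_len _ _ C _ (pc_refl _ _ C _ _ H)).
    assert (H3 := pc_len_step _ _ C _ _ H). lia.
  - assert (H2 := pc_len _ _ C _ (proj1 H)).
    assert (length w = n) by apply H. rewrite (new_length _ _ H). lia.
  - assert (length w = n) by apply H. rewrite (new_length _ _ H). lia.
  - rewrite (new_length _ _ H), (new_length _ _ H'). lia.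
Qed.

(** An edge without a lift in [R] starts at the top level, so it is missing and [new] lifts it. *)
Lemma extend_full u z : R u u -> E (f u) z -> exists y, extend u y /\ f y = z.
Proof.
  intros Hu Hz.
  destruct (classic (exists y, R u y /\ f y = z)) as [(y & Hy & e)|no].
  { exists y; split; [now apply ext_old|easy]. }
  assert (length u = n).
  { assert (H1 := pc_len _ _ C _ Hu).
    destruct (Nat.lt_ge_cases (length u) n) as [L|]; [|lia].
    exfalso; apply no, (pc_full _ _ C); auto. }
  exists (new u z); split; [|easy]. apply ext_up; repeat split; auto.
Qed.

(** The new vertex [x] arises from [u] and from [v] over the same image, so these are twins. *)
Lemma extend_down u v x : extend u x -> extend v x -> length u <= n -> length v <= n ->
  length x = S n -> R u v /\ T (f u) (f v) (f x).
Proof.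
  intros Hu Hv Lu Lv Lx.
  destruct (extend_up u x) as (Mu & eu); auto.
  destruct (extend_up v x) as (Mv & ev); auto.
  apply new_eq; auto; congruence.
Qed.

(** Neighbours are compared by level. An old and a new neighbour cannot share an image, because new
    vertices arise only from edges without a lift. *)
Lemma extend_inj u a b : extend u a -> extend u b -> f a = f b -> a = b.
Proof.
  intros Ha Hb e.
  assert (La := extend_len _ _ Ha). assert (Lb := extend_len _ _ Hb).
  destruct (Nat.le_gt_cases (length u) n) as [Lu|Lu].
  - assert (mixed : forall a b, extend u a -> extend u b -> f a = f b ->
      length a = S n -> length b <= n -> False).
    { clear a b Ha Hb e La Lb; intros a b Ha Hb e La Lb.
      destruct (extend_up u a) as ((_ & _ & _ & no) & _); auto.
      apply no; exists b; split; [|easy]. now apply extend_old. }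
    destruct (Nat.le_gt_cases (length a) n) as [La'|La'];
    destruct (Nat.le_gt_cases (length b) n) as [Lb'|Lb'].
    + apply (pc_inj _ _ C u); auto; now apply extend_old.
    + exfalso; apply (mixed b a); auto; lia.
    + exfalso; apply (mixed a b); auto; lia.
    + destruct (extend_up u a) as (_ & ea); auto; [lia|].
      destruct (extend_up u b) as (_ & eb); auto; [lia|]. congruence.
  (* Here [u] and [a] arise from one old vertex [v]. As a twin of [v] over [f u], the vertex [b] is
     adjacent to [v] and would lift the edge from [v] to [f a]. *)
  - assert (mixed : forall a b, extend u a -> extend u b -> f a = f b ->
      length a = S n -> length b <= n -> False).
    { clear a b Ha Hb e La Lb; intros a b Ha Hb e La Lb.
      assert (Lu' := extend_len _ _ Ha).
      destruct (extend_new u a) as (v & Mv & (_ & _ & _ & no) & Ht & eu & _); auto; [lia|].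
      destruct (extend_up b u) as (Mb & eb); auto; [now apply extend_sym|lia|].
      apply no; exists b; split; [|easy].
      apply (new_eq v b (f u)); auto; congruence. }
    destruct (Nat.le_gt_cases (length a) n) as [La'|La'];
    destruct (Nat.le_gt_cases (length b) n) as [Lb'|Lb'].
    + destruct (extend_down a b u) as (Hab & _); auto;
        try (now apply extend_sym); [lia|].
      apply (pc_inj _ _ C a); auto. apply (pc_refl _ _ C _ _ Hab).
    + exfalso; apply (mixed b a); auto; lia.
    + exfalso; apply (mixed a b); auto; lia.
    (* The old vertices below the pairs [u], [a] and [u], [b] are twins over [f u]. The flag link of
       [f u] makes them twins over the common image of [a] and [b] too. *)
    + destruct (extend_new u a) as (v & Mv & Mva & Ht & eu & ea); auto; try lia.
      destruct (extend_new u b) as (v' & Mv' & Mvb & Ht' & eu' & eb); auto; try lia.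
      destruct (new_eq v v' (f u)) as (_ & _ & Hvv & Htv); auto; [congruence|].
      rewrite ea, eb, e. apply twin_new. rewrite e in Ht, Mva.
      split; [|split; [|split]]; auto.
      apply (star_triangle V K Kc Kl (f u)); perm.
Qed.

(** With [u] old, a new neighbour records a missing edge at [u]. An old neighbour is joined to it
    when it is a twin of [u]; two new neighbours are joined by [ext_new] through [u] itself. *)
Lemma extend_tri_low u a b : length u <= n -> extend u a -> extend u b ->
  (extend a b <-> T (f u) (f a) (f b)).
Proof.
  assert (mixed : forall u a b, length u <= n -> extend u a -> extend u b ->
      length a = S n -> length b <= n -> (extend a b <-> T (f u) (f a) (f b))).
  { clear u a b; intros u a b Lu Ha Hb La Lb.
    destruct (extend_up u a) as (Mu & ea); auto.
    assert (Rub : R u b) by now apply extend_old.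
    split.
    - intros Hab. destruct (extend_down u b a); auto; [now apply extend_sym|perm].
    (* At level [n] the missing edge spreads to [b], a twin of [u]. Below that level the star of [b]
       is complete, a contradiction. *)
    - intros Ht. destruct (Nat.eq_dec (length b) n) as [Lb'|Lb'].
      + assert (Mb : missing b (f a)) by (apply (missing_spread u); auto; perm).
        assert (e : a = new b (f a)).
        { rewrite ea at 1. apply twin_new. split; [|split; [|split]]; auto. perm. }
        rewrite e. now apply ext_down.
      + exfalso; apply (missing_lower u (f a) b); auto; [now apply (pc_sym _ _ C)|lia|perm]. }
  intros Lu Ha Hb.
  assert (La := extend_len _ _ Ha). assert (Lb := extend_len _ _ Hb).
  destruct (Nat.le_gt_cases (length a) n) as [La'|La'];
  destruct (Nat.le_gt_cases (length b) n) as [Lb'|Lb'].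
  - transitivity (R a b).
    + split; [intros; now apply extend_old|apply ext_old].
    + apply (pc_tri _ _ C); now apply extend_old.
  - transitivity (extend b a); [split; apply extend_sym|].
    rewrite (mixed u b a); auto; [split; intros; perm|lia].
  - apply mixed; auto; lia.
  - destruct (extend_up u a) as (Ma & ea); auto; [lia|].
    destruct (extend_up u b) as (Mb & eb); auto; [lia|].
    split; intros H; [|rewrite ea, eb; now apply ext_new].
    (* The triangle is known at some [v] below both; [u] and [v] are twins over [f a] and over
       [f b], which carries it to [u]. *)
    destruct (extend_new a b) as (v & Mva & Mvb & Ht & ea' & eb'); auto; try lia.
    destruct (new_eq u v (f a)) as (_ & _ & _ & Hta); auto; [congruence|].
    destruct (new_eq u v (f b)) as (_ & _ & _ & Htb); auto; [congruence|].
    apply (star_triangle V K Kc Kl (f v)); perm.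
Qed.

Lemma extend_common x y : extend x y -> length x = S n -> length y = S n ->
  exists v, length v = n /\ extend v x /\ extend v y.
Proof.
  intros H Lx Ly. destruct (extend_new x y) as (v & Mx & My & Ht & ex & ey); auto.
  exists v; split; [apply Mx|]. split; [rewrite ex|rewrite ey]; now apply ext_up.
Qed.

(** One direction is the triangle condition at [a]. For the other, a vertex [v] below [x] and [y] is
    joined to [a], and the condition is read off at [v]. *)
Lemma extend_tri_mixed x a y : length x = S n -> length a <= n -> length y = S n ->
  extend x a -> extend x y -> (extend a y <-> T (f x) (f a) (f y)).
Proof.
  intros Lx La Ly Ha Hy. assert (Ha' := extend_sym _ _ Ha). split; intros H.
  - assert (T (f a) (f x) (f y)) by now apply extend_tri_low. perm.
  - destruct (extend_common x y) as (v & Lv & Hvx & Hvy); auto.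
    destruct (extend_down v a x) as (Hva & Htva); auto; [lia|].
    assert (T (f v) (f x) (f y)) by (apply extend_tri_low; auto; lia).
    apply (extend_tri_low v); auto; [lia|now apply ext_old|].
    apply (star_triangle V K Kc Kl (f x)); perm.
Qed.

(** Each direction produces a 4-cycle through lower vertices. Either diagonal yields one old vertex
    below [x], [y] and [z], which reduces the claim to an old centre. *)
Lemma extend_tri_high x y z : length x = S n -> length y = S n -> length z = S n ->
  extend x y -> extend x z -> (extend y z <-> T (f x) (f y) (f z)).
Proof.
  intros Lx Ly Lz Hxy Hxz.
  destruct (extend_common x y) as (v & Lv & Hvx & Hvy); auto.
  destruct (extend_common x z) as (v' & Lv' & Hvx' & Hvz'); auto.
  assert (Txy : T (f v) (f x) (f y)) by (apply extend_tri_low; auto; lia).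
  assert (Txz : T (f v') (f x) (f z)) by (apply extend_tri_low; auto; lia).
  destruct (extend_down v v' x) as (Hvv & Htvv); auto; try lia.
  split; intros H.
  - destruct (extend_common y z) as (v'' & Lv'' & Hvy'' & Hvz''); auto.
    assert (common : forall w, length w = n -> extend w x -> extend w y -> extend w z ->
      T (f x) (f y) (f z)).
    { intros w Lw Hx Hy Hz.
      assert (T (f w) (f x) (f y)) by (apply extend_tri_low; auto; lia).
      assert (T (f w) (f y) (f z)) by (apply extend_tri_low; auto; lia).
      assert (T (f w) (f x) (f z)) by (apply extend_tri_low; auto; lia).
      apply (star_triangle V K Kc Kl (f w)); perm. }
    destruct (extend_down v v'' y) as (Hvv2 & Htvv2); auto; try lia.
    destruct (extend_down v' v'' z) as (Hvv3 & Htvv3); auto; try lia.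
    assert (T (f v) (f v') (f v'')) by now apply (pc_tri _ _ C).
    (* The diagonal [x v''] puts [v''] below all three, the diagonal [y v'] puts [v'] there. *)
    destruct (star_four_cycle V K Kc Kl (f v) (f x) (f y) (f v'') (f v')) as [D|D];
      try perm.
    + apply (common v''); auto. apply extend_sym, (extend_tri_low v); auto; [lia|].
      now apply ext_old.
    + apply (common v'); auto. apply extend_sym, (extend_tri_low v); auto; [lia|].
      now apply ext_old.
  - assert (common : forall w, length w = n -> extend w x -> extend w y -> extend w z ->
      extend y z).
    { intros w Lw Hx Hy Hz.
      assert (T (f w) (f x) (f y)) by (apply extend_tri_low; auto; lia).
      assert (T (f w) (f x) (f z)) by (apply extend_tri_low; auto; lia).
      apply (extend_tri_low w); auto; [lia|].
      apply (star_triangle V K Kc Kl (f x)); perm. }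
    (* Around [x], the diagonal [y v'] puts [v'] below [y], and the diagonal [v z] puts [v] below
       [z]. *)
    destruct (star_four_cycle V K Kc Kl (f x) (f y) (f v) (f v') (f z)) as [D|D];
      try perm.
    + apply (common v'); auto. apply (extend_tri_mixed x); auto; try lia;
      [now apply extend_sym|perm].
    + apply (common v); auto. apply (extend_tri_mixed x); auto; try lia.
      now apply extend_sym.
Qed.

Lemma extend_tri u a b : extend u a -> extend u b ->
  (extend a b <-> T (f u) (f a) (f b)).
Proof.
  intros Ha Hb.
  assert (La := extend_len _ _ Ha). assert (Lb := extend_len _ _ Hb).
  destruct (Nat.le_gt_cases (length u) n) as [Lu|Lu]; [now apply extend_tri_low|].
  destruct (Nat.le_gt_cases (length a) n) as [La'|La'];
  destruct (Nat.le_gt_cases (length b) n) as [Lb'|Lb'].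
  - destruct (extend_down a b u); auto; try (now apply extend_sym); [lia|].
    split; intros; [perm|now apply ext_old].
  - apply extend_tri_mixed; auto; lia.
  - transitivity (extend b a); [split; apply extend_sym|].
    rewrite (extend_tri_mixed u b a); auto; try lia. split; intros; perm.
  - apply extend_tri_high; auto; lia.
Qed.

Lemma extend_refl x y : extend x y -> extend x x.
Proof.
  assert (new_refl : forall u z, missing u z -> extend (new u z) (new u z)).
  { intros u z H. apply ext_new; auto. apply edge_triangle; auto. apply H. }
  intros [a b H|w z H|w z H|u z z' H H' Ht]; auto; apply ext_old.
  - apply (pc_refl _ _ C _ _ H).
  - apply H.
Qed.

Lemma extend_edge x y : extend x y -> E (f x) (f y).
Proof.
  intros [a b H|w z H|w z H|u z z' H H' Ht].
  - now apply (pc_edge _ _ C).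
  - apply H.
  - apply edge_sym; auto; apply H.
  - now apply (triangle_edge V K Kc (f u)).
Qed.

Lemma extend_cover : partial_cover (S n) extend.
Proof.
  assert (npos := pc_len _ _ C _ (pc_base _ _ C)).
  split.
  - exact extend_sym.
  - exact extend_refl.
  - apply ext_old, (pc_base _ _ C).
  - intros x Hx Lx. apply (pc_base_uniq _ _ C); auto. apply extend_old; auto; lia.
  - intros x Hx. now apply extend_len in Hx.
  - intros x y Hx. now apply extend_len in Hx.
  - exact extend_edge.
  - exact extend_inj.
  - exact extend_tri.
  - intros u z Hu Lu Hz. apply extend_full; auto. apply extend_old; auto; lia.
  - intros x y i H Lx Ly. destruct (Nat.eq_dec (S i) n) as [e|ne].
    + rewrite e in *. now apply extend_common.
    + assert (L := extend_len _ _ H).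
      destruct (pc_common _ _ C x y i) as (u & Lu & Hx & Hy); auto.
      * apply extend_old; auto; lia.
      * exists u; split; [|split]; auto; now apply ext_old.
  - intros u v x Hu Hv L Lx. apply ext_old.
    destruct (Nat.eq_dec (length u) n).
    + apply (extend_down u v x); auto; lia.
    + assert (H := extend_len _ _ Hu).
      apply (pc_down _ _ C u v x); auto; apply extend_old; auto; lia.
Qed.

End Step.

(** * The stages and their union *)

Fixpoint stage (n : nat) : list V -> list V -> Prop :=
  match n with
  | 0 => fun x y => x = [o] /\ y = [o]
  | S n => extend (S n) (stage n)
  end.

(** The bound is [S n] because the base vertex [[o]] already has length 1. *)
Lemma stage_cover : vertex V K o -> forall n, partial_cover (S n) (stage n).
Proof.
  intros Ho; induction n as [|n IH]; [|now apply extend_cover].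
  assert (Eo : E o o) by now apply vertex_edge.
  split; simpl.
  - tauto.
  - tauto.
  - tauto.
  - tauto.
  - intros x [-> _]; simpl; lia.
  - intros x y [-> ->]; simpl; lia.
  - intros x y [-> ->]; easy.
  - intros u a b [_ ->] [_ ->]; easy.
  - intros u a b [-> ->] [_ ->]; split; [|easy]. intros _. now apply edge_triangle.
  - intros u z [-> _]; simpl; lia.
  - intros x y i [-> _]; simpl; lia.
  - intros u v x [-> ->]; simpl; lia.
Qed.

Definition cover (x y : list V) : Prop := exists n, stage n x y.

(** Stages only grow, so finitely many adjacencies of the union can be examined at one common
    stage. *)
Lemma stage_le n m x y : n <= m -> stage n x y -> stage m x y.
Proof. induction 1; auto. intros; simpl; apply ext_old; auto. Qed.

End Cover.

(** On vertices [d] is the graph distance from [o]: [lay_step] bounds it above, and [lay_common]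
    with [x = y] gives a neighbour one level down. *)
Record layering {V : Type} (K : (V -> Prop) -> Prop) (o : V) (d : V -> nat) : Prop := {
  lay_base : forall v, vertex V K v -> (d v = 0 <-> v = o);
  lay_step : forall x y, edge_or_eq V K x y -> d y <= S (d x);
  lay_common : forall x y i, edge_or_eq V K x y -> d x = S i -> d y = S i ->
    exists u, d u = i /\ triangle V K u x y;
  lay_down : forall u v x, edge_or_eq V K u x -> edge_or_eq V K v x ->
    d u = d v -> d x = S (d u) -> triangle V K x u v;
  lay_flag : forall x y z, edge_or_eq V K x y -> edge_or_eq V K y z ->
    edge_or_eq V K x z -> triangle V K x y z }.

(** * Path lifting and the identification of the cover with the complex *)

Section Bijection.
Variables (V : Type) (K : (V -> Prop) -> Prop) (o : V).
Hypothesis Kc : is_complex K.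
Hypothesis Kl : locally_six_large V K.
Hypothesis Ko : vertex V K o.

Local Notation E := (edge_or_eq V K).
Local Notation T := (triangle V K).
Local Notation f := (hd o).
Local Notation R := (cover V K o).

Let C n := stage_cover V K o Kc Kl Ko n.

Lemma cover_sym x y : R x y -> R y x.
Proof. intros (n & H); exists n. now apply (pc_sym _ _ _ _ _ (C n)). Qed.

Lemma cover_refl x y : R x y -> R x x.
Proof. intros (n & H); exists n. now apply (pc_refl _ _ _ _ _ (C n) x y). Qed.

Lemma cover_base : R [o] [o].
Proof. exists 0; split; easy. Qed.

Lemma cover_edge x y : R x y -> E (f x) (f y).
Proof. intros (n & H). now apply (pc_edge _ _ _ _ _ (C n)). Qed.

Lemma stage_lift n x y m : stage V K o n x y -> stage V K o (n + m) x y.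
Proof. apply stage_le; lia. Qed.

Lemma cover_inj u a b : R u a -> R u b -> f a = f b -> a = b.
Proof.
  intros (n & Ha) (m & Hb). apply (pc_inj _ _ _ _ _ (C (n + m)) u).
  - now apply stage_lift.
  - rewrite Nat.add_comm. now apply stage_lift.
Qed.

Lemma cover_tri u a b : R u a -> R u b -> (R a b <-> T (f u) (f a) (f b)).
Proof.
  intros (n & Ha) (m & Hb). split.
  - intros (k & Hab). apply (pc_tri _ _ _ _ _ (C (n + m + k)));
      [apply (stage_le _ _ _ n)|apply (stage_le _ _ _ m)|apply (stage_le _ _ _ k)];
      auto; lia.
  - intros Ht. exists (n + m). apply (pc_tri _ _ _ _ _ (C (n + m)) u); auto;
      [apply (stage_le _ _ _ n)|apply (stage_le _ _ _ m)]; auto; lia.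
Qed.

Lemma cover_full u z : R u u -> E (f u) z -> exists y, R u y /\ f y = z.
Proof.
  intros (n & Hu) Hz.
  destruct (pc_full _ _ _ _ _ (C (S n)) u z) as (y & Hy & e); auto.
  - apply (stage_le _ _ _ n); auto.
  - apply (pc_len _ _ _ _ _ (C n)) in Hu. lia.
  - exists y; split; [now exists (S n)|easy].
Qed.

Lemma cover_len x : R x x -> 1 <= length x.
Proof. intros (n & H). now apply (pc_len _ _ _ _ _ (C n)) in H. Qed.

Lemma cover_base_uniq x : R x x -> length x = 1 -> x = [o].
Proof. intros (n & H). now apply (pc_base_uniq _ _ _ _ _ (C n)). Qed.

Lemma cover_len_step x y : R x y -> length y <= S (length x).
Proof. intros (n & H). now apply (pc_len_step _ _ _ _ _ (C n)). Qed.

Lemma cover_common x y i : R x y -> length x = S (S i) -> length y = S (S i) ->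
  exists u, length u = S i /\ R u x /\ R u y.
Proof.
  intros (n & H) Lx Ly.
  destruct (pc_common _ _ _ _ _ (C n) x y i) as (u & Lu & Hx & Hy); auto.
  exists u; split; [easy|split; now exists n].
Qed.

Lemma cover_down u v x : R u x -> R v x -> length u = length v ->
  length x = S (length u) -> R u v.
Proof.
  intros (n & Hu) (m & Hv) L Lx. exists (n + m).
  apply (pc_down _ _ _ _ _ (C (n + m)) u v x); auto;
    [apply (stage_le _ _ _ n)|apply (stage_le _ _ _ m)]; auto; lia.
Qed.

(** A path in the cover from [x] to [y], recorded by the images [p] of its vertices after the
    first. *)
Fixpoint lift (x p y : list V) : Prop :=
  match p with
  | [] => x = y
  | a :: q => exists x', R x x' /\ f x' = a /\ lift x' q y
  end.

Lemma lift_app x p q y : lift x (p ++ q) y <-> exists z, lift x p z /\ lift z q y.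
Proof.
  revert x; induction p as [|a p IH]; intros x; simpl.
  - split; [intros H; now exists x|now intros (z & -> & H)].
  - split.
    + intros (x' & Hx & Ha & H). apply IH in H as (z & Hp & Hq).
      exists z; split; [|easy]. now exists x'.
    + intros (z & (x' & Hx & Ha & Hp) & Hq). exists x'; split; [easy|split; [easy|]].
      apply IH. now exists z.
Qed.

Lemma lift_edge_path x p y : R x x -> lift x p y -> edge_path V K (f x :: p).
Proof.
  revert x; induction p as [|a p IH]; intros x Hx H.
  - apply (edge_vertex V K Kc _ (f x)). now apply cover_edge.
  - destruct H as (x' & Hx' & <- & H). split; [|split].
    + right. now apply cover_edge in Hx'.
    + apply (edge_vertex V K Kc _ (f x)). now apply cover_edge.
    + apply IH; [|easy]. now apply (cover_refl _ x), cover_sym.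
Qed.

Lemma lift_exists x x' p y :
  R x x -> R x' x' -> f x = f x' -> lift x p y -> exists y', lift x' p y'.
Proof.
  revert x x'; induction p as [|a p IH]; intros x x' Hx Hx' e H; simpl.
  - now exists x'.
  - destruct H as (x1 & H1 & <- & H).
    destruct (cover_full x' (f x1)) as (x1' & H1' & e1); auto.
    { rewrite <- e. now apply cover_edge. }
    destruct (IH x1 x1') as (y' & Hy'); auto.
    + now apply (cover_refl _ x), cover_sym.
    + now apply (cover_refl _ x'), cover_sym.
    + now exists y', x1'.
Qed.

(** Unique lifting is run backwards from the common end [y]. *)
Lemma lift_inj x x' p y : f x = f x' -> lift x p y -> lift x' p y -> x = x'.
Proof.
  revert x x'; induction p as [|a p IH]; intros x x' e H H'; simpl in *.
  - congruence.
  - destruct H as (x1 & H1 & e1 & H). destruct H' as (x2 & H2 & e2 & H').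
    assert (x1 = x2) by (apply IH; congruence). subst x2.
    apply (cover_inj x1); auto; now apply cover_sym.
Qed.

(** [cover_common] at the pair [x], [x] gives a neighbour one level down; repeating this ends at
    [[o]]. *)
Lemma lift_descend x : R x x -> exists p, lift x p [o].
Proof.
  remember (length x) as n eqn:L; revert x L; induction n as [|n IH]; intros x L Hx.
  - apply cover_len in Hx; lia.
  - destruct n as [|i].
    + exists []. now apply cover_base_uniq.
    + destruct (cover_common x x i) as (u & Lu & Hu & _); auto.
      destruct (IH u) as (p & Hp); auto; [now apply (cover_refl _ x)|].
      exists (f u :: p), u. split; [now apply cover_sym|easy].
Qed.

Lemma lift_ascend x : R x x -> exists p, lift [o] p x.
Proof.
  remember (length x) as n eqn:L; revert x L; induction n as [|n IH]; intros x L Hx.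
  - apply cover_len in Hx; lia.
  - destruct n as [|i].
    + exists []. symmetry. now apply cover_base_uniq.
    + destruct (cover_common x x i) as (u & Lu & Hu & _); auto.
      destruct (IH u) as (p & Hp); auto; [now apply (cover_refl _ x)|].
      exists (p ++ [f x]). apply lift_app. exists u. split; [easy|]. now exists x.
Qed.

(** Path moves act on full vertex lists, so here the starting vertex is part of [p]. *)
Definition traces (p y : list V) : Prop :=
  match p with [] => False | a :: q => a = o /\ lift [o] q y end.

Lemma traces_app l a m y :
  traces (l ++ a :: m) y <-> exists x, traces (l ++ [a]) x /\ f x = a /\ lift x m y.
Proof.
  destruct l as [|b l]; simpl.
  - split.
    + intros (-> & H). now exists [o].
    + now intros (x & (-> & <-) & _ & H).
  - change (a :: m) with ([a] ++ m). rewrite app_assoc, lift_app. split.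
    + intros (-> & z & Hz & H). exists z. split; [easy|split; [|easy]].
      apply lift_app in Hz as (z' & _ & x' & _ & <- & <-). easy.
    + intros (x & (-> & Hx) & _ & H). split; [easy|now exists x].
Qed.

(** By [cover_tri] the triangle lifts to the cover, so the detour through [b] ends where the direct
    edge does. *)
Lemma lift_triangle x b c m y : T (f x) b c -> lift x (b :: c :: m) y <-> lift x (c :: m) y.
Proof.
  intros Ht; simpl; split.
  - intros (x1 & H1 & <- & x2 & H2 & <- & H). exists x2. split; [|easy].
    apply (cover_tri x1); auto; [now apply cover_sym|now apply triangle_sym].
  - intros (x2 & H2 & <- & H).
    destruct (cover_full x b) as (x1 & H1 & <-).
    + now apply (cover_refl _ x2).
    + apply (triangle_edge V K Kc (f x2)). now apply triangle_rot, triangle_rot.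
    + exists x1; split; [easy|split; [easy|]]. exists x2; split; [|easy].
      now apply (cover_tri x).
Qed.

Lemma lift_stutter x m y : R x x -> lift x (f x :: m) y <-> lift x m y.
Proof.
  intros Hx; simpl; split.
  - intros (x1 & H1 & e & H). assert (x1 = x) by now apply (cover_inj x).
    now subst x1.
  - intros H. now exists x.
Qed.

Lemma lift_end x p y : R x x -> lift x p y -> R y y.
Proof.
  revert x; induction p as [|a p IH]; intros x Hx H; simpl in H.
  - now subst.
  - destruct H as (x' & Hx' & _ & H). apply (IH x'); auto.
    now apply (cover_refl _ x), cover_sym.
Qed.

(** This is the homotopy invariance of the end of a lift, checked on each elementary move. *)
Lemma traces_move p q y : path_move V K p q -> traces p y <-> traces q y.
Proof.
  intros [l1 l2 a b c H|l1 l2 a]; simpl; rewrite 2 traces_app.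
  - split; intros (x & Hx & <- & Hl); exists x; split; auto; split; auto.
    + apply (proj1 (lift_triangle x b c l2 y H)), Hl.
    + apply (proj2 (lift_triangle x b c l2 y H)), Hl.
  - assert (Hr : forall x, traces (l1 ++ [a]) x -> R x x).
    { intros x; destruct (l1 ++ [a]) as [|b l]; [easy|]. intros (_ & H).
      apply lift_end in H; auto. apply cover_base. }
    split; intros (x & Hx & <- & Hl); exists x; split; auto; split; auto.
    + apply (proj1 (lift_stutter x l2 y (Hr x Hx))), Hl.
    + apply (proj2 (lift_stutter x l2 y (Hr x Hx))), Hl.
Qed.

Lemma traces_homotopic p q y : path_homotopic V K p q -> traces p y <-> traces q y.
Proof.
  induction 1; [now apply traces_move|tauto|tauto|tauto].
Qed.

Hypothesis Ks : simply_connected V K.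

(** A path up to [x] followed by a copy of a descent from [x'] projects to a loop at [o]. The loop
    is null-homotopic, so its lift closes up at [[o]], and backward uniqueness along the descent
    gives [x = x']. *)
Lemma cover_hd_inj x x' : R x x -> R x' x' -> f x = f x' -> x = x'.
Proof.
  intros Hx Hx' e.
  destruct (lift_ascend x Hx) as (p & Hp).
  destruct (lift_descend x' Hx') as (q & Hq).
  (* A stationary step at [[o]] gives the loop the shape [v :: p ++ [v]] even when [q] is empty. *)
  assert (Hq' : lift x' (q ++ [o]) [o]).
  { apply lift_app. exists [o]; split; [easy|]. exists [o].
    split; [apply cover_base|easy]. }
  destruct (lift_exists x' x (q ++ [o]) [o]) as (y & Hy); auto.
  assert (Hpq : lift [o] ((p ++ q) ++ [o]) y).
  { rewrite <- app_assoc. apply lift_app. now exists x. }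
  assert (Hh : traces (o :: (p ++ q) ++ [o]) y <-> traces [o] y).
  { apply traces_homotopic, (proj2 Ks).
    apply (lift_edge_path [o] _ y); [apply cover_base|easy]. }
  destruct (proj1 Hh) as (_ & <-); [easy|].
  apply (lift_inj x x' (q ++ [o]) [o]); auto.
Qed.

Lemma cover_hd_surj v : vertex V K v -> exists x, R x x /\ f x = v.
Proof.
  intros Hv.
  assert (H : clos_refl_trans V (edge V K) o v) by now apply (proj2 (proj1 Ks)).
  assert (Hgen : forall a b, clos_refl_trans V (edge V K) a b ->
    (exists x, R x x /\ f x = a) -> exists x, R x x /\ f x = b).
  { induction 1 as [a b Hab|a|a b c _ IH1 _ IH2]; auto.
    intros (x & Hx & <-). destruct (cover_full x b) as (y & Hy & e); auto.
    exists y; split; [|easy]. now apply (cover_refl _ x), cover_sym. }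
  apply (Hgen o v H). exists [o]; split; [apply cover_base|easy].
Qed.

Lemma layering_exists : exists d, layering K o d.
Proof.
  (* [g] inverts the projection on vertices, and the level of [g v] serves as the distance. *)
  pose (g v := epsilon (inhabits []) (fun x => R x x /\ f x = v)).
  assert (gs : forall v, vertex V K v -> R (g v) (g v) /\ f (g v) = v)
    by (intros v Hv; apply epsilon_spec; now apply cover_hd_surj).
  assert (gf : forall x, R x x -> g (f x) = x).
  { intros x Hx. destruct (gs (f x)) as (H1 & H2).
    - apply (edge_vertex V K Kc _ (f x)). now apply cover_edge.
    - now apply cover_hd_inj. }
  assert (ge : forall a b, E a b -> R (g a) (g b)).
  { intros a b H. destruct (gs a) as (Ha & ea); [now apply edge_vertex in H|].
    destruct (cover_full (g a) b) as (y & Hy & <-); [easy|now rewrite ea|].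
    rewrite (gf y); auto. now apply (cover_refl _ (g a)), cover_sym. }
  assert (gv : forall a b, E a b -> f (g a) = a)
    by (intros a b H; apply gs; now apply edge_vertex in H).
  assert (glen : forall a b, E a b -> 1 <= length (g a)).
  { intros a b H. apply cover_len, gs. now apply edge_vertex in H. }
  exists (fun v => pred (length (g v))). split.
  - intros v Hv. destruct (gs v Hv) as (H & e). split.
    + intros L. assert (L' := cover_len _ H).
      rewrite <- e, (cover_base_uniq (g v)); auto; lia.
    + intros ->. rewrite (gf [o] cover_base : g o = [o]). easy.
  - intros x y H. assert (H' := cover_len_step _ _ (ge x y H)).
    assert (Hx := glen x y H). lia.
  - intros x y i H Lx Ly.
    destruct (cover_common (g x) (g y) i) as (u & Lu & Hx & Hy); auto; try lia.
    exists (f u). rewrite gf by now apply cover_refl in Hx. split; [lia|].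
    rewrite <- (gv x y H), <- (gv y x) by now apply edge_sym.
    apply (cover_tri u); auto.
  - intros u v x Hu Hv L Lx.
    assert (Lu := glen _ _ Hu). assert (Lv := glen _ _ Hv).
    assert (Hu' := ge _ _ Hu). assert (Hv' := ge _ _ Hv).
    assert (Huv : R (g u) (g v)) by (apply (cover_down _ _ (g x)); auto; lia).
    apply (cover_tri (g x)) in Huv; auto using cover_sym.
    rewrite (gv u x Hu), (gv v x Hv), (gv x u) in Huv; auto. now apply edge_sym.
  - intros x y z Hxy Hyz Hxz.
    assert (H := ge _ _ Hyz). apply (cover_tri (g x)) in H; auto.
    rewrite (gv x y Hxy), (gv y z Hyz), (gv z y) in H; auto. now apply edge_sym.
Qed.

End Bijection.

(** * Deleting stars by collapses *)

Lemma collapsible_ext {V : Type} (C C' : (V -> Prop) -> Prop) :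
  (forall s, C s <-> C' s) -> collapsible C -> collapsible C'.
Proof. intros H. now rewrite (pred_ext C C' H). Qed.

Definition delete_star {V : Type} (C : (V -> Prop) -> Prop) (s : V -> Prop) :=
  fun t => C t /\ ~ subset s t.

Lemma delete_star_complex {V : Type} (C : (V -> Prop) -> Prop) s :
  is_complex C -> is_complex (delete_star C s).
Proof.
  intros (H1 & H2). split; [intros t (Ht & _); auto|].
  intros t u (Ht & nt) Hu Hut. split; [now apply (H2 t)|].
  intros Hsu; apply nt; intros x Hx; auto.
Qed.

Lemma delete_star_twice {V : Type} (C : (V -> Prop) -> Prop) (s t : V -> Prop) :
  subset s t -> delete_star (delete_star C t) s = delete_star C s.
Proof.
  intros Hst. apply pred_ext; intros u; unfold delete_star. split; [tauto|].
  intros (Hu & nu). split; [split|]; auto. intros Htu. apply nu; intros x Hx; auto.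
Qed.

Lemma finite_vset_incl {V : Type} (s : V -> Prop) l :
  (forall x, s x -> In x l) -> finite_vset V s.
Proof.
  intros H.
  exists (filter (fun x => if excluded_middle_informative (s x) then true else false) l).
  intros x; rewrite filter_In. specialize (H x).
  destruct (excluded_middle_informative (s x)); intuition congruence.
Qed.

(* The maximal simplex [s * (v :: l)] over [s] is a cone with apex [v]: first delete
   the star of [s * w] for a further vertex [w], after which [w] is gone from the
   star of [s]; with [v] alone left, [s] is a free face. *)
Lemma collapse_star {V : Type} l : forall (C : (V -> Prop) -> Prop) (s : V -> Prop) v,
  is_complex C -> nonempty V s -> (forall x, In x (v :: l) -> ~ s x) ->
  C (fun x => s x \/ In x (v :: l)) ->
  (forall t, C t -> subset s t -> forall x, t x -> s x \/ In x (v :: l)) ->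
  collapsible (delete_star C s) -> collapsible C.
Proof.
  induction l as [|w l IH]; intros C s v HC (x0 & Hx0) Hdisj Hmax Hstar Hcol.
  - apply (coll_step V C s (fun x => s x \/ In x [v])).
    + split; [|split; [easy|split; [split|]]].
      * apply (proj2 HC _ s Hmax); [now exists x0|intros x; tauto].
      * intros x; tauto.
      * intros H. apply (Hdisj v); [now left|]. apply H; right; now left.
      * intros t Ht Hst. destruct (classic (t v)) as [Htv|Htv].
        -- right; intros x; split; [now apply Hstar|].
           intros [Hx|[<-|[]]]; auto.
        -- left; intros x; split; [|apply Hst]. intros Hx.
           destruct (Hstar t Ht Hst x Hx) as [|[->|[]]]; easy.
    + revert Hcol. apply collapsible_ext; intros t. unfold delete_star, remove_pair. split.
      * intros (Ht & nt). split; [easy|split; intros H; apply nt; intros x Hx; apply H; auto].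
      * intros (Ht & n1 & n2). split; [easy|]. intros Hst.
        destruct (classic (t v)) as [Htv|Htv].
        -- apply n2; intros x; split; [now apply Hstar|]. intros [Hx|[<-|[]]]; auto.
        -- apply n1; intros x; split; [|apply Hst]. intros Hx.
           destruct (Hstar t Ht Hst x Hx) as [|[->|[]]]; easy.
  (* A repeated entry adds no vertex to the cone. *)
  - destruct (classic (In w (v :: l))) as [Hw|Hw].
    { apply (IH C s v); auto.
      - now exists x0.
      - intros x Hx; apply Hdisj. simpl in *; tauto.
      - apply (proj2 HC _ _ Hmax); [exists x0; tauto|]. intros x; simpl; tauto.
      - intros t Ht Hst x Hx. specialize (Hstar t Ht Hst x Hx). simpl in *.
        destruct Hstar as [?|[?|[->|?]]]; tauto. }
    assert (Hws : ~ s w) by (apply Hdisj; simpl; tauto).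
    set (sw := fun x => s x \/ x = w).
    apply (IH C sw v); auto.
    + exists x0; now left.
    + intros x Hx [Hs| ->]; [|easy]. apply (Hdisj x); [simpl in *; tauto|easy].
    + apply (proj2 HC _ _ Hmax); [exists x0; left; now left|].
      intros x [[Hx| ->]|Hx]; simpl in *; tauto.
    + intros t Ht Hst x Hx. unfold sw.
      assert (Hst' : subset s t) by (intros y Hy; apply Hst; now left).
      destruct (Hstar t Ht Hst' x Hx) as [?|[?|[->|?]]]; simpl; tauto.
    + apply (IH (delete_star C sw) s v).
      * now apply delete_star_complex.
      * now exists x0.
      * intros x Hx; apply Hdisj; simpl in *; tauto.
      * split.
        -- apply (proj2 HC _ _ Hmax); [exists x0; tauto|]. intros x; simpl; tauto.
        -- intros H. destruct (H w (or_intror eq_refl)); auto.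
      * intros t (Ht & nt) Hst x Hx.
        destruct (Hstar t Ht Hst x Hx) as [?|[?|[->|?]]]; simpl; try tauto.
        exfalso; apply nt. intros y [Hy| ->]; auto.
      * rewrite delete_star_twice; [easy|]. intros x; unfold sw; tauto.
Qed.

(** * Balls and projections of simplices to the next lower sphere *)

Section Balls.
Variables (V : Type) (K : (V -> Prop) -> Prop) (o : V) (d : V -> nat).
Hypothesis Kc : is_complex K.
Hypothesis Kl : locally_six_large V K.
Hypothesis Kf : locally_finite K.
Hypothesis Ko : vertex V K o.
Hypothesis D : layering K o d.

Local Notation E := (edge_or_eq V K).
Local Notation T := (triangle V K).

Definition ball (n : nat) : (V -> Prop) -> Prop :=
  fun s => K s /\ forall x, s x -> d x <= n.

Definition on_sphere (n : nat) (s : V -> Prop) : Prop := forall x, s x -> d x = n.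

Definition proj (n : nat) (s : V -> Prop) : V -> Prop :=
  fun w => d w = n /\ forall x, s x -> E w x.

Lemma simplex_edge (s : V -> Prop) x y : K s -> s x -> s y -> E x y.
Proof. intros Hs Hx Hy. apply (face V K Kc s _ x Hs); [tauto|]. intros z [->| ->]; auto. Qed.

Lemma ball_complex n : is_complex (ball n).
Proof.
  split; [intros s (Hs & _); now apply Kc|].
  intros s t (Hs & H) Ht Hst. split; [now apply (proj2 Kc s)|]. auto.
Qed.

(* Helly property: three vertices [a, b, c] below all but one of [x, y, z] span with
   them a 4-cycle [y z b c] in the link of [a]. *)
Lemma common_projection n l : l <> [] -> (forall x, In x l -> d x = S n) ->
  (forall x y, In x l -> In y l -> E x y) ->
  exists w, d w = n /\ forall x, In x l -> E w x.
Proof.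
  remember (length l) as m eqn:Hm.
  revert l Hm; induction m as [m IH] using lt_wf_ind; intros l Hm ne Hd He.
  destruct l as [|x [|y [|z l]]]; [easy| | |].
  - destruct (lay_common _ _ _ D x x n) as (u & Hu & Ht); try (apply Hd || apply He; now left).
    exists u; split; [easy|]. intros ? [<-|[]].
    now apply triangle_edge12 in Ht.
  - destruct (lay_common _ _ _ D x y n) as (u & Hu & Ht); simpl in *; auto.
    exists u; split; [easy|]. intros ? [<-|[<-|[]]].
    + now apply triangle_edge12 in Ht.
    + now apply triangle_edge13 in Ht.
  - destruct (IH (length (y :: z :: l))) with (l := y :: z :: l) as (a & Da & Ha);
      [simpl in *; lia|easy|easy|intros; apply Hd; now right|intros; apply He; now right|].
    destruct (IH (length (x :: z :: l))) with (l := x :: z :: l) as (b & Db & Hb);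
      [simpl in *; lia|easy|easy|intros; apply Hd; simpl in *; tauto
      |intros; apply He; simpl in *; tauto|].
    destruct (IH (length (x :: y :: l))) with (l := x :: y :: l) as (c & Dc & Hc);
      [simpl in *; lia|easy|easy|intros; apply Hd; simpl in *; tauto
      |intros; apply He; simpl in *; tauto|].
    assert (down : forall u v w, In w (x :: y :: z :: l) -> d u = n -> d v = n ->
      E u w -> E v w -> E u v).
    { intros u v w Hw Du Dv Hu Hv. apply (triangle_edge V K Kc w).
      apply (lay_down _ _ _ D); auto; [lia|]. rewrite Du; auto. }
    assert (Eab : E a b) by (apply (down a b z); simpl in *; auto).
    assert (Eac : E a c) by (apply (down a c y); simpl in *; auto).
    assert (Ebc : E b c) by (apply (down b c x); simpl in *; auto).
    (* The diagonal [y b] or [z c] supplies the one adjacency that [b] or [c] lacks. *)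
    destruct (star_four_cycle V K Kc Kl a y z b c) as [H|H].
    + apply (lay_flag _ _ _ D); simpl in *; auto.
    + apply (lay_flag _ _ _ D); simpl in *; auto. apply edge_sym; auto.
    + apply (lay_flag _ _ _ D); auto.
    + apply (lay_flag _ _ _ D); simpl in *; auto.
    + exists b; split; [easy|]. intros w [<-|[<-|Hw]]; [apply Hb; now left| |apply Hb; now right].
      apply edge_sym, (triangle_edge V K Kc a); auto.
    + exists c; split; [easy|].
      intros w [<-|[<-|[<-|Hw]]]; [apply Hc; simpl; tauto..| |apply Hc; simpl; tauto].
      apply edge_sym, (triangle_edge V K Kc a); auto.
Qed.

Lemma proj_nonempty n s : K s -> on_sphere (S n) s -> nonempty V (proj n s).
Proof.
  intros Hs Hd. destruct (proj1 Kc s Hs) as ((l & Hl) & (x0 & Hx0)).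
  destruct (common_projection n l) as (w & Hw & H).
  - intros ->. now apply Hl in Hx0.
  - intros x Hx; now apply Hd, Hl.
  - intros x y Hx Hy; apply (simplex_edge s); now try apply Hl.
  - exists w; split; [easy|]. intros x Hx; now apply H, Hl.
Qed.

(** All these vertices lie in the star of one vertex of [s], hence are finitely many. Projected
    vertices are pairwise adjacent by [lay_down], and flagness of the link fills in the simplex. *)
Lemma proj_join n s : K s -> on_sphere (S n) s -> K (fun x => s x \/ proj n s x).
Proof.
  intros Hs Hd. destruct (proj1 Kc s Hs) as (_ & (x & Hx)).
  assert (Hv : vertex V K x) by (apply (face V K Kc s _ x Hs); [easy|now intros ? ->]).
  destruct (Kf x Hv) as (l & Hl).
  assert (H : K (fun y => y = x \/ (s y \/ proj n s y))).
  { apply (star_flag V K Kc Kl); auto.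
    - apply (finite_vset_incl _ l). intros y [Hy|(_ & Hy)]; [now apply (Hl s)|].
      apply (Hl _ (Hy x Hx)); tauto.
    - intros a b [Ha|(Da & Ha)] [Hb|(Db & Hb)].
      + apply (lay_flag _ _ _ D); now apply (simplex_edge s).
      + apply (lay_flag _ _ _ D); [now apply (simplex_edge s)|apply edge_sym; auto..].
      + apply (lay_flag _ _ _ D); [apply edge_sym; auto|auto|now apply (simplex_edge s)].
      + apply (lay_down _ _ _ D); auto; [congruence|]. rewrite Da; auto. }
  apply (face V K Kc _ _ x H); [now left|]. intros y Hy; now right.
Qed.

(** * Removing the outer sphere *)

Section Sphere.
Variable n : nat.

(** The invariant of the collapse: each remaining simplex of the outer sphere keeps its join with
    its projection. *)
Definition inside (C : (V -> Prop) -> Prop) : Prop :=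
  is_complex C /\ (forall s, C s -> ball (S n) s) /\
  (forall s, C s -> on_sphere (S n) s -> C (fun x => s x \/ proj n s x)).

(** Joining with a projection adds only vertices of level [n], so it cannot create a simplex over
    [s]. *)
Lemma inside_delete C s : inside C -> on_sphere (S n) s -> inside (delete_star C s).
Proof.
  intros (H1 & H2 & H3) Hs. split; [|split].
  - now apply delete_star_complex.
  - intros t (Ht & _); auto.
  - intros t (Ht & nt) Hd. split; [now apply H3|].
    intros H; apply nt; intros x Hx. destruct (H x Hx) as [|(Dx & _)]; auto.
    rewrite (Hs x Hx) in Dx; lia.
Qed.

(** [l] lists the sphere vertices by which [s] may still be enlarged. If [v] enlarges [s], the star
    of the larger simplex goes first. With [l] empty, the join of [s] with its projection is the
    only maximal simplex over [s]. *)
Lemma remove_star l : forall C s, inside C -> C s -> on_sphere (S n) s ->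
  (forall t, C t -> subset s t -> forall x, t x -> d x = S n -> s x \/ In x l) ->
  collapsible (delete_star C s) -> collapsible C.
Proof.
  induction l as [|v l IH]; intros C s HC Hs Hd Hstar Hcol.
  - destruct HC as (HC & Hball & Hcone).
    assert (Ks : K s) by now apply Hball.
    destruct (proj1 HC s Hs) as (_ & (x & Hx)).
    destruct (proj_nonempty n s Ks Hd) as (w & Hw).
    assert (Kp : K (proj n s)).
    { apply (face V K Kc _ _ w (proj_join n s Ks Hd)); auto. }
    destruct (proj1 Kc _ Kp) as (([|v l] & Hl) & _); [now apply Hl in Hw|].
    apply (collapse_star l C s v); auto.
    + now exists x.
    + intros y Hy Hsy. apply Hl in Hy as (Dy & _). rewrite (Hd y Hsy) in Dy; lia.
    + apply (proj2 HC _ _ (Hcone s Hs Hd)); [exists x; tauto|].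
      intros y [Hy|Hy]; [tauto|]. right; now apply Hl.
    + intros t Ht Hst y Hy. destruct (classic (s y)) as [|ny]; [tauto|]. right.
      destruct (Hball t Ht) as (Kt & Bt).
      apply Hl. split; [|intros z Hz; apply (simplex_edge t); auto].
      (* [y] is off the outer sphere by [Hstar], and not below level [n] because it is adjacent to
         [x]. *)
      assert (d y <= S n) by auto.
      assert (d y <> S n) by (intros Dy; destruct (Hstar t Ht Hst y Hy Dy); easy).
      assert (Dx := lay_step _ _ _ D y x (simplex_edge t y x Kt Hy (Hst x Hx))).
      rewrite (Hd x Hx) in Dx; lia.
  - set (sv := fun x => s x \/ x = v).
    destruct (classic (~ s v /\ C sv /\ d v = S n)) as [(nv & Hsv & Dv)|no].
    + assert (Hd' : on_sphere (S n) sv) by (intros x [Hx| ->]; auto).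
      apply (IH C sv); auto.
      * intros t Ht Hst x Hx Dx. unfold sv.
        assert (Hst' : subset s t) by (intros y Hy; apply Hst; now left).
        destruct (Hstar t Ht Hst' x Hx Dx) as [?|[->|?]]; tauto.
      * apply (IH (delete_star C sv) s); auto.
        -- now apply inside_delete.
        -- split; [easy|]. intros H; apply nv, H; now right.
        -- intros t (Ht & nt) Hst x Hx Dx.
           destruct (Hstar t Ht Hst x Hx Dx) as [?|[->|?]]; try tauto.
           exfalso; apply nt. intros y [Hy| ->]; auto.
        -- rewrite delete_star_twice; [easy|]. intros x; unfold sv; tauto.
    + apply (IH C s); auto. intros t Ht Hst x Hx Dx.
      destruct (Hstar t Ht Hst x Hx Dx) as [?|[->|?]]; try tauto.
      left; apply NNPP; intros nx; apply no. split; [easy|split; [|easy]].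
      apply (proj2 (proj1 HC) t); auto; [exists x; now right|].
      intros y [Hy| ->]; auto.
Qed.

(** The stars of the sphere vertices are removed one at a time; each removal preserves [inside]. *)
Lemma remove_sphere l : forall C, inside C ->
  (forall s x, C s -> s x -> d x = S n -> In x l) ->
  collapsible (fun s => C s /\ forall x, s x -> d x <= n) -> collapsible C.
Proof.
  induction l as [|v l IH]; intros C HC Hl Hcol.
  - revert Hcol. apply collapsible_ext; intros s; split; [tauto|]. intros Hs; split; [easy|].
    intros x Hx. assert (d x <= S n) by now apply (proj1 (proj2 HC) s Hs).
    assert (d x <> S n) by (intros Dx; apply (Hl s x Hs Hx Dx)). lia.
  - destruct (classic (C (fun x => x = v) /\ d v = S n)) as [(Hv & Dv)|no].
    + assert (Hd : on_sphere (S n) (fun x => x = v)) by now intros x ->.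
      apply (remove_star (v :: l) C (fun x => x = v)); auto.
      * intros t Ht _ x Hx Dx; right; now apply (Hl t).
      * apply IH; [now apply inside_delete| |].
        -- intros t x (Ht & nt) Hx Dx. destruct (Hl t x Ht Hx Dx) as [<-|]; auto.
           exfalso; apply nt; now intros y ->.
        -- revert Hcol. apply collapsible_ext; intros s; unfold delete_star; split; [|tauto].
           intros (Hs & Hb); split; [split|]; auto.
           intros H. assert (d v <= n) by now apply Hb, H. lia.
    + apply IH; auto. intros s x Hs Hx Dx. destruct (Hl s x Hs Hx Dx) as [<-|]; auto.
      exfalso; apply no; split; auto. apply (proj2 (proj1 HC) s); auto; [now exists v|].
      now intros y ->.
Qed.

End Sphere.

(** * Finiteness, collapsibility and exhaustion by balls *)

Lemma neighbours_finite l : exists l', forall x y, In x l -> E x y -> In y l'.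
Proof.
  induction l as [|v l (l' & IH)]; [now exists []|].
  destruct (classic (vertex V K v)) as [Hv|nv].
  - destruct (Kf v Hv) as (lv & Hlv). exists (lv ++ l').
    intros x y [<-|Hx] H; apply in_or_app; [left|right; now apply (IH x)].
    apply (Hlv _ H); tauto.
  - exists l'. intros x y [<-|Hx] H; [|now apply (IH x)].
    now apply edge_vertex in H.
Qed.

(** Every vertex of level [n + 1] has a neighbour of level [n], and neighbours of finitely many
    vertices are finitely many. *)
Lemma ball_finite n : exists l, forall v, vertex V K v -> d v <= n -> In v l.
Proof.
  induction n as [|n (l & IH)].
  - exists [o]; intros v Hv Dv. left. symmetry. apply (lay_base _ _ _ D); [easy|lia].
  - destruct (neighbours_finite l) as (l' & Hl'). exists (l ++ l'). intros v Hv Dv.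
    apply in_or_app. destruct (Nat.eq_dec (d v) (S n)) as [e|ne]; [right|left; apply IH; auto; lia].
    destruct (lay_common _ _ _ D v v n) as (u & Du & Ht); auto; [now apply vertex_edge|].
    assert (Euv : E u v) by now apply triangle_edge12 in Ht.
    apply (Hl' u); auto. apply IH; [now apply edge_vertex in Euv|lia].
Qed.

Lemma simplex_vertex s x : K s -> s x -> vertex V K x.
Proof. intros Hs Hx. apply (face V K Kc s _ x Hs); [easy|now intros y ->]. Qed.

(** The ball of radius 0 is the vertex [o], and removing the outer sphere of a ball leaves the
    previous ball. *)
Lemma ball_collapsible n : collapsible (ball n).
Proof.
  induction n as [|n IH].
  - apply (coll_point V _ o). intros s; split.
    + intros (Hs & Hd). destruct (proj1 Kc s Hs) as (_ & (x0 & Hx0)).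
      assert (all : forall x, s x -> x = o).
      { intros x Hx. apply (lay_base _ _ _ D); [now apply (simplex_vertex s)|].
        specialize (Hd x Hx); lia. }
      intros x; split; [apply all|]. intros ->. now rewrite <- (all x0).
    + intros H. split.
      * apply (face V K Kc _ _ o Ko); [now apply H|]. intros x Hx; now apply H.
      * intros x Hx. apply H in Hx as ->.
        rewrite (proj2 (lay_base _ _ _ D o Ko)); auto.
  - destruct (ball_finite (S n)) as (l & Hl).
    apply (remove_sphere n l).
    + split; [apply ball_complex|split; [auto|]]. intros s (Hs & _) Hd. split.
      * now apply proj_join.
      * intros x [Hx|(Dx & _)]; [rewrite (Hd x Hx)|]; lia.
    + intros s x (Hs & _) Hx Dx. apply Hl; [now apply (simplex_vertex s)|lia].
    + revert IH. apply collapsible_ext; intros s; unfold ball; split; [|tauto].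
      intros (Hs & H); split; [split|]; auto.
Qed.

Lemma ball_exhausts s : K s -> exists n, ball n s.
Proof.
  intros Hs. destruct (proj1 Kc s Hs) as ((l & Hl) & _).
  exists (list_max (map d l)). split; [easy|]. intros x Hx.
  assert (H := proj1 (list_max_le (map d l) _) (le_n _)).
  rewrite Forall_forall in H. now apply H, in_map, Hl.
Qed.

End Balls.

Theorem theorem3p2 (V : Type) (K : (V -> Prop) -> Prop) :
  systolic K -> locally_finite K ->
  exists L : nat -> ((V -> Prop) -> Prop),
    (forall n, subcomplex (L n) K) /\
    (forall n, finite_cplx (L n)) /\
    (forall n, collapsible (L n)) /\
    (forall n s, L n s -> L (S n) s) /\
    (forall s, K s -> exists n, L n s).
Proof.
  intros (Kc & ((o & Ko) & _) & Ks & Kl) Kf.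
  destruct (layering_exists V K o Kc Kl Ko Ks) as (d & D).
  exists (ball V K d). split; [|split; [|split; [|split]]].
  - intros n; split; [now apply ball_complex|]. now intros s (Hs & _).
  - intros n. destruct (ball_finite V K o d Kc Kf D n) as (l & Hl).
    exists l. intros s (Hs & Hd) x Hx. apply Hl; auto. now apply (simplex_vertex V K Kc s).
  - intros n. now apply (ball_collapsible V K o).
  - intros n s (Hs & Hd); split; auto.
  - intros s Hs. now apply ball_exhausts.
Qed.
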